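(* Let $u\ge1$ and $\theta\in(0,1]$ be real numbers such that $(1-\theta)u\le1$, let $\kappa>0$ and let $\varepsilon>0$. The function $\varrho_{\theta,\kappa}$ (defined in the context) satisfies: (i) If $0<\theta\le\frac12$, then $\varrho_{\theta,\kappa}(u)=\kappa\,(1-(1-\theta)u)\,u^{\kappa-1}$ for $1<u\le\frac1{1-\theta}$. (ii) If $\frac12<\theta\le\frac23$, then $$\varrho_{\theta,1}(u)=\begin{cases}1-(1-\theta)u&\text{if }1<u\le\frac1\theta,\\ 1-(1-\theta)u+\log\left(\frac1u+1-\theta\right)&\text{if }\frac1\theta<u\le2,\\ 1-(1-\theta)u+\log\left(\frac1u+1-\theta\right)+(1-\theta)u\log\frac u2&\text{if }2<u\le\frac1{1-\theta}.\end{cases}$$ (iii) If $\theta=1-\varepsilon$, then $\varrho_{\theta,1}(u)=\varrho(u)+O(\varepsilon)$, where $\varrho$ is Dickman's function.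
   Context: Dickman's function $\varrho$ is the unique function on $[0,\infty)$ that is continuous, differentiable on $(1,\infty)$, equal to $1$ on $[0,1]$, and satisfies $u\varrho'(u)+\varrho(u-1)=0$ for $u>1$. Definition of $\varrho_{\theta,\kappa}$. For $k\ge1$ put $f_k(u;t_1,\dots,t_k):=\prod_{i=1}^k\frac{1}{u-t_1-\cdots-t_i}$. For $k\ge2$, $u>0$ and $0\le v\le\min(1,u)$ let $$V_k(u,v):=\{\boldsymbol t\in(0,1)^k:\ t_1+\cdots+t_{k-1}<u-1<t_1+\cdots+t_k<u-v\},$$ $$\mu_k(u,v):=\frac1u\int_{V_k(u,v)}f_{k-1}(u;t_1,\dots,t_{k-1})\,\mathrm d\boldsymbol t,$$ and $\mu_1(u,v):=\frac1u\,\mathrm{mes}\big((0,1)\cap(u-1,u-v)\big)$ (Lebesgue measure). Put $\mu^{(\kappa)}(u,v):=\sum_{k\ge1}\kappa^k\mu_k(u,v)$ (a convergent series) and $$\varrho_{\theta,\kappa}(u):=\mu^{(\kappa)}(u,(1-\theta)u).$$ *)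

(* Defs.v *)
From HB Require Import structures.
From mathcomp Require Import all_boot all_order all_algebra.
From mathcomp Require Import all_classical all_reals all_analysis.
Import Order.TTheory GRing.Theory Num.Theory numFieldNormedType.Exports.

Set Implicit Arguments.
Unset Strict Implicit.
Unset Printing Implicit Defensive.

Local Open Scope classical_set_scope.
Local Open Scope ring_scope.

Section LebesgueTuple.
Variable R : realType.
Local Notation mR := (measurableTypeR R).

Definition tuple_cons n (x : mR * n.-tuple mR) : n.+1.-tuple mR :=
  [tuple of x.1 :: x.2].

Lemma measurable_tuple_cons n : measurable_fun setT (@tuple_cons n).
Proof. exact: measurable_cons. Qed.

Definition cons_measure n (m : {sigma_finite_measure set (n.-tuple mR) -> \bar R}) :
    set (n.+1.-tuple mR) -> \bar R :=
  pushforward (lebesgue_measure \x m)%E (@tuple_cons n).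

Section ConsMeasure.
Variables (n : nat) (m : {sigma_finite_measure set (n.-tuple mR) -> \bar R}).
Local Open Scope ereal_scope.

Let cons0 : cons_measure m set0 = 0.
Proof. by rewrite /cons_measure /pushforward preimage_set0 measure0. Qed.

Let cons_ge0 A : 0 <= cons_measure m A.
Proof. by rewrite /cons_measure /pushforward measure_ge0. Qed.

Let cons_sigma_additive : semi_sigma_additive (cons_measure m).
Proof.
move=> F mF tF mUF; rewrite /cons_measure /pushforward preimage_bigcup.
have mpre A : measurable A -> measurable (@tuple_cons n @^-1` A).
  by move=> mA; rewrite -[X in measurable X]setTI; exact: measurable_tuple_cons.
apply: measure_semi_sigma_additive.
- by move=> i; exact: mpre.
- apply/trivIsetP => /= i j _ _ ij; rewrite -preimage_setI.
  by move/trivIsetP : tF => /(_ _ _ _ _ ij) ->//; rewrite preimage_set0.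
- by rewrite -preimage_bigcup; exact: mpre.
Qed.

HB.instance Definition _ := isMeasure.Build _ _ _ (cons_measure m)
  cons0 cons_ge0 cons_sigma_additive.

Let cons_sigma_finite : sigma_finite setT (cons_measure m).
Proof.
have /sigma_finiteP[F [FT ndF Foo]] := sigma_finiteT (@lebesgue_measure R).
have /sigma_finiteP[G [GT ndG Goo]] := sigma_finiteT m.
pose uncons (t : n.+1.-tuple mR) : mR * n.-tuple mR :=
  (thead t, [tuple of behead t]).
have munc : measurable_fun setT uncons.
  by apply/measurable_fun_pairP; split;
    [exact: measurable_tnth|exact: measurable_behead].
exists (fun i => uncons @^-1` (F i `*` G i)).
  apply/esym; rewrite -subTset => t _.
  have [i _ Fi] : (\bigcup_i F i) (thead t) by rewrite -FT.
  have [j _ Gj] : (\bigcup_i G i) [tuple of behead t] by rewrite -GT.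
  exists (maxn i j) => //; split => /=.
    by move: Fi; exact/subsetPset/ndF/leq_maxl.
  by move: Gj; exact/subsetPset/ndG/leq_maxr.
move=> i; have [mF Fi] := Foo i; have [mG Gi] := Goo i; split.
  by rewrite -[X in measurable X]setTI; apply: munc => //; exact: measurableX.
rewrite /cons_measure /pushforward -comp_preimage.
have -> : uncons \o @tuple_cons n = id.
  by apply/funext => -[x t]; congr pair; apply/val_inj.
by rewrite preimage_id product_measure1E// lte_mul_pinfty// ge0_fin_numE.
Qed.

HB.instance Definition _ := Measure_isSigmaFinite.Build _ _ _ (cons_measure m)
  cons_sigma_finite.

End ConsMeasure.

(* Lebesgue measure on R^n, i.e. the n-fold product of the one-dimensional
   Lebesgue measure; see [lebesgue_tuple_box]. *)
Fixpoint lebesgue_tuple n : {sigma_finite_measure set (n.-tuple mR) -> \bar R} :=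
  match n with
  | 0 => \d_([tuple] : 0.-tuple mR)
  | n'.+1 => cons_measure (lebesgue_tuple n')
  end.

Lemma lebesgue_tuple_box n (A : 'I_n -> set mR) :
  (forall i, measurable (A i)) ->
  lebesgue_tuple n [set t | forall i, A i (tnth t i)] =
  (\prod_(i < n) lebesgue_measure (A i))%E.
Proof.
elim: n A => [|n IH] A mA.
  rewrite big_ord0 /= diracE mem_set//= => -[] //.
pose B := [set t : n.-tuple mR | forall i, A (lift ord0 i) (tnth t i)].
rewrite big_ord_recl -IH// -/B.
rewrite /= /cons_measure /pushforward -product_measure1E//; last first.
  have -> : B = \bigcap_(i in [set: 'I_n]) (@tnth _ _ ^~ i @^-1` A (lift ord0 i)).
    by apply/seteqP; split=> [t Bt i _|t Bt i]; [exact: Bt|exact: (Bt i)].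
  apply: fin_bigcap_measurable; first exact: finite_finset.
  move=> i _.
  by rewrite -[X in measurable X]setTI; exact: measurable_tnth.
congr (_ _); apply/seteqP; split=> -[x t] /=.
  move=> At; split; first by have := At ord0; rewrite tnth0.
  by move=> i; have := At (lift ord0 i); rewrite tnthS.
move=> [Ax Bt] i; case: (unliftP ord0 i) => [j|] ->; last by rewrite tnth0.
by rewrite tnthS; exact: Bt.
Qed.

End LebesgueTuple.
Arguments lebesgue_tuple R n : clear implicits.

Section Rho.
Variable R : realType.
Implicit Types (u v theta kappa : R) (k : nat).

(* t_1 + ... + t_i; the coordinates of a sequence are numbered from 0. *)
Definition partial_sum (t : seq R) (i : nat) : R := \sum_(0 <= j < i) t`_j.

(* f_k(u; t_1, ..., t_k); coordinates of t beyond the k-th are ignored. *)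
Definition fk k u (t : seq R) : R :=
  \prod_(1 <= i < k.+1) (u - partial_sum t i)^-1.

Definition Vk k u v : set (k.-tuple (measurableTypeR R)) :=
  [set t | [/\ forall i : 'I_k, 0 < tnth t i < 1,
               partial_sum t k.-1 < u - 1
             & u - 1 < partial_sum t k < u - v]].
Arguments Vk k u v : clear implicits.

Local Open Scope ereal_scope.

Definition muk k u v : \bar R :=
  if k == 1%N then
    (u^-1)%:E * lebesgue_measure (`]0%R, 1%R[ `&` `](u - 1)%R, (u - v)%R[)
  else
    (u^-1)%:E * \int[lebesgue_tuple R k]_(t in Vk k u v) (fk k.-1 u t)%:E.

(* The terms are nonnegative where the series is used, so that it always has a
   sum in \bar R, which is finite exactly when the series converges. *)
Definition mu_series kappa u v : \bar R :=
  \sum_(1 <= k <oo) (kappa ^+ k)%:E * muk k u v.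

Definition varrho theta kappa u : \bar R :=
  mu_series kappa u ((1 - theta) * u)%R.

Local Close Scope ereal_scope.

(* The values of [rho] on negative numbers are irrelevant. *)
Definition is_dickman (rho : R -> R) : Prop :=
  [/\ {within `[0, +oo[, continuous rho},
      forall u, 1 < u -> derivable rho u 1,
      forall u, 0 <= u <= 1 -> rho u = 1
    & forall u, 1 < u -> u * rho^`()%classic u + rho (u - 1) = 0].

End Rho.
Arguments Vk {R} k u v.

(* Main.v *)
Require Import Defs.
From mathcomp Require Import all_boot all_order all_algebra.
From mathcomp Require Import all_classical all_reals all_analysis.
From mathcomp Require Import ring lra.
From mathcomp Require Import measurable_realfun.
Import Order.TTheory GRing.Theory Num.Theory numFieldNormedType.Exports.

Set Implicit Arguments.
Unset Strict Implicit.
Unset Printing Implicit Defensive.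

Local Open Scope classical_set_scope.
Local Open Scope ring_scope.

(* Substituting [x = u - t_1] in the defining integrals shows that
   [u * mu_k(u, v)] is the value at [u] of [T^(k-1) g], where
     [g(x) = mes((0, 1) `&` (x - 1, x - v))],
     [T h (x) = \int_(max(1, x - 1))^x h(y) / y dy].
   Hence the partial sums [S_n] of [u * mu^(kappa)(u, v)] satisfy
   [S_(n+1) = kappa g + kappa T S_n], and the series sums to any nonnegative, locally
   bounded solution [H] of [H = kappa g + kappa T H]: positivity of [T] gives
   [S_n <= H] by induction, and [H - S_n <= C x^(2 kappa) / 2^n] because
   [kappa T (x^(2 kappa)) <= x^(2 kappa) / 2].  For [H(x) = x m(x)] the equation is
   a delay equation for [m], solved explicitly in (i) and (ii), and solved by
   Dickman's function when [kappa = 1] and [v = 0].  For (iii), passing from [v = 0]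
   to [v = epsilon u] lowers [g] by at most [v] on [1, 2] and leaves it unchanged
   beyond, and [v min(x, 2)] dominates the effect of this on the solution. *)

(** * The transfer operator [T] on nonnegative functions *)

Section Transfer.
Variable R : realType.
Implicit Types (x y t v kappa : R) (g h : R -> \bar R) (n : nat).
Local Open Scope ereal_scope.

Local Notation leb := (@lebesgue_measure R).

(** [T] is written in the variable [t = x - y], so that [t] is the coordinate [t_1] of the multiple
    integrals. The interval is empty for [x <= 1]. *)
Definition transfer g x : \bar R :=
  \int[leb]_(t in `]0%R, Num.min 1%R (x - 1)%R[)
    (((x - t)^-1)%:E * g (x - t)%R).

(** Writing [1 / x] as [x * (x ^ 2) ^ (-1)] reduces this to measurability of real powers. The
    identity survives at [0], whose inverse is [0]. *)
Lemma measurable_inv : measurable_fun [set: R] (fun x => x^-1%R).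
Proof.
have -> : (fun x => x^-1%R) = (fun x => x * (x ^+ 2) `^ (- 1))%R :> (R -> R).
  apply/funext => x; rewrite powR_inv1 ?sqr_ge0//.
  have [->|x0] := eqVneq x 0%R; first by rewrite mul0r invr0.
  by field.
apply: measurable_funM => //.
by apply: (measurableT_comp (measurable_powR _)); exact: exprn_measurable.
Qed.

Lemma itv_min_gt1 x t : (t \in `]0, Num.min 1 (x - 1)[)%R -> (1 < x - t)%R.
Proof. by rewrite in_itv/= lt_min => /andP[_ /andP[_]]; lra. Qed.

Let integrand_ge0 g x t : (forall y, 0 <= g y) ->
  (t \in `]0, Num.min 1 (x - 1)[)%R -> 0 <= ((x - t)^-1)%:E * g (x - t)%R.
Proof.
move=> g0 /itv_min_gt1 xt; rewrite mule_ge0// lee_fin invr_ge0.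
by rewrite (le_trans ler01) ?ltW.
Qed.

Let measurable_integrand g x (D : set R) : measurable_fun setT g ->
  measurable_fun D (fun t => ((x - t)^-1)%:E * g (x - t)%R).
Proof.
move=> mg; apply: measurable_funTS.
have mB : measurable_fun [set: R] (fun t => x - t)%R by exact: measurable_funB.
apply: emeasurable_funM; last exact: measurableT_comp.
apply/measurable_EFinP; exact: (measurableT_comp measurable_inv).
Qed.

Lemma transfer_ge0 g x : (forall y, 0 <= g y) -> 0 <= transfer g x.
Proof. by move=> g0; apply: integral_ge0 => t; exact: integrand_ge0. Qed.

(** Tonelli: [transfer g] is the marginal integral of a nonnegative measurable function on the
    plane, cut off to the region [0 < t < min(1, x - 1)]. *)
Lemma measurable_transfer g : measurable_fun setT g -> (forall y, 0 <= g y) ->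
  measurable_fun setT (transfer g).
Proof.
move=> mg g0.
pose D : set (R * R) := [set p | (0 < p.2 < Num.min 1 (p.1 - 1))%R].
have mD : measurable D.
  have m1 : measurable_fun setT (fun p : R * R => 0 < p.2)%R.
    by apply: measurable_fun_ltr; [exact: measurable_cst|exact: measurable_snd].
  have m2 : measurable_fun setT (fun p : R * R => p.2 < Num.min 1 (p.1 - 1))%R.
    apply: measurable_fun_ltr; first exact: measurable_snd.
    apply: measurable_minr; first exact: measurable_cst.
    by apply: measurable_funB; [exact: measurable_fst|exact: measurable_cst].
  have -> : D = (setT `&` (fun p => (0 < p.2)%R) @^-1` [set true]) `&`
      (setT `&` (fun p => (p.2 < Num.min 1 (p.1 - 1))%R) @^-1` [set true]).
    by rewrite !setTI; apply/seteqP; split=> p /=; [move=> /andP|move/andP].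
  by apply: measurableI; [exact: m1|exact: m2].
pose f p := (((p.1 - p.2)^-1)%:E * g (p.1 - p.2)%R) : \bar R.
have mf : measurable_fun setT (f \_ D).
  apply/(measurable_restrictT _ _).1 => //; apply: measurable_funTS.
  have mB : measurable_fun setT (fun p : R * R => p.1 - p.2)%R.
    by apply: measurable_funB; [exact: measurable_fst|exact: measurable_snd].
  apply: emeasurable_funM; last exact: (measurableT_comp mg).
  by apply/measurable_EFinP; exact: (measurableT_comp measurable_inv).
have f0 p : 0 <= (f \_ D) p.
  by apply: erestrict_ge0 => -[x t] /= xt; exact: integrand_ge0.
rewrite (_ : transfer g = fubini_F leb (f \_ D)).
  exact: measurable_fun_fubini_tonelli_F.
apply/funext => x; rewrite /transfer integral_mkcond; apply: eq_integral => t _.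
rewrite !patchE; congr (if _ then _ else _).
Qed.

Lemma transferD g h x : measurable_fun setT g -> measurable_fun setT h ->
  (forall y, 0 <= g y) -> (forall y, 0 <= h y) ->
  transfer (g \+ h) x = transfer g x + transfer h x.
Proof.
move=> mg mh g0 h0; rewrite /transfer -ge0_integralD//=.
- by apply: eq_integral => t _; rewrite ge0_muleDr.
- by move=> t; exact: integrand_ge0.
- exact: measurable_integrand.
- by move=> t; exact: integrand_ge0.
- exact: measurable_integrand.
Qed.

Lemma transferZ g k x : measurable_fun setT g -> (forall y, 0 <= g y) ->
  (0 <= k)%R -> transfer (fun y => k%:E * g y) x = k%:E * transfer g x.
Proof.
move=> mg g0 k0; rewrite /transfer -ge0_integralZl ?lee_fin//=.
- by apply: eq_integral => t _; rewrite muleCA.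
- exact: measurable_integrand.
- by move=> t; exact: integrand_ge0.
Qed.

Lemma transfer_sum (f : nat -> R -> \bar R) n x :
  (forall i, measurable_fun setT (f i)) -> (forall i y, 0 <= f i y) ->
  transfer (fun y => \sum_(i < n) f i y) x = \sum_(i < n) transfer (f i) x.
Proof.
move=> mf f0; rewrite /transfer.
under eq_integral do rewrite ge0_sume_distrr//.
rewrite ge0_integral_sum//.
- by move=> i; exact: measurable_integrand.
- by move=> i t; exact: integrand_ge0.
Qed.

(** The argument [x - t] stays in [(1, x)], so a comparison there suffices. This locality lets the
    later inductions run on a fixed interval [[1, u]]. *)
Lemma le_transfer g h x : measurable_fun setT g -> measurable_fun setT h ->
  (forall y, (1 < y < x)%R -> 0 <= g y) ->
  (forall y, (1 < y < x)%R -> g y <= h y) -> transfer g x <= transfer h x.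
Proof.
move=> mg mh g0 gh; apply: ge0_le_integral => //=.
- move=> t /[dup] /itv_min_gt1 xt; rewrite in_itv/= => /andP[t0 _].
  by rewrite mule_ge0 ?g0 ?lee_fin ?invr_ge0//; [lra|apply/andP; split; lra].
- exact: measurable_integrand.
- exact: measurable_integrand.
- move=> t /[dup] /itv_min_gt1 xt; rewrite in_itv/= => /andP[t0 _].
  by rewrite lee_wpmul2l ?gh ?lee_fin ?invr_ge0//; [lra|apply/andP; split; lra].
Qed.

Lemma eq_transfer g h x : (forall y, (1 < y < x)%R -> g y = h y) ->
  transfer g x = transfer h x.
Proof.
move=> gh; apply: eq_integral => t; rewrite inE/= => /[dup] /itv_min_gt1 xt.
by rewrite in_itv/= => /andP[t0 _]; rewrite gh//; apply/andP; split; lra.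
Qed.

(** The factor [y] cancels the weight [1 / y], and [t |-> - M (x - t)] is then a primitive of the
    integrand. The limits [t = 0] and [t = min(1, x - 1)] become [x] and [max(1, x - 1)]. *)
Lemma transfer_primitive (m M : R -> R) x : (1 <= x)%R ->
  (forall y, (0 < y)%R -> {for y, continuous m}) ->
  (forall y, (0 < y)%R -> is_derive y 1%R M (m y)) ->
  transfer (fun y => (y * m y)%:E) x = (M x - M (Num.max 1 (x - 1)))%:E.
Proof.
move=> x1 cm dM; rewrite /transfer.
have -> : Num.max 1%R (x - 1)%R = (x - Num.min 1 (x - 1))%R.
  by rewrite maxElt minElt; case: ifP => _; lra.
set b := Num.min _ _.
have b1 : (x - b >= 1)%R by rewrite lerBrDr -lerBrDl ge_min lexx orbT.
have [b0|b0] := leP b 0%R.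
  have -> : b = 0%R.
    by apply/eqP; rewrite eq_le b0/= le_min ler01/=; lra.
  by rewrite set_itvE integral_set0 subr0 subrr.
have dF t : (0 <= t <= b)%R ->
    is_derive t 1%R (fun t => - M (x - t))%R (m (x - t))%R.
  move=> /andP[t0 tb]; have /dM dMt : (0 < x - t)%R by lra.
  have dB : is_derive t 1%R (fun t : R => x - t)%R (0 - 1)%R.
    exact: (is_deriveB (is_derive_cst x t 1%R) (is_derive_id t 1%R)).
  have dMB : is_derive t 1%R (fun t : R => M (x - t))%R (m (x - t) * (0 - 1))%R.
    exact: (@is_derive1_comp _ M (fun t => x - t)%R t _ _ dMt dB).
  have -> : m (x - t)%R = (- (m (x - t) * (0 - 1)))%R by ring.
  exact: (is_deriveN dMB).
have cont_mt t : (0 <= t <= b)%R -> {for t, continuous (fun t => m (x - t)%R)}.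
  move=> /andP[t0 tb]; apply: continuous_comp; last by apply: cm; lra.
  by apply: cvgB; [exact: cvg_cst|exact: cvg_id].
have cont_F t : (0 <= t <= b)%R -> {for t, continuous (fun t => - M (x - t))%R}.
  move=> /dF[+ _]; move/derivable1_diffP; exact: differentiable_continuous.
transitivity (\int[leb]_(t in `]0%R, b[) (m (x - t))%:E).
  apply: eq_integral => t; rewrite inE/= => /itv_min_gt1 xt.
  by rewrite -EFinM mulKf// gt_eqF// (lt_trans ltr01).
rewrite -(@integral_itv_bndoo _ _ _ _ true false).
  rewrite (@continuous_FTC2 _ _ (fun t => - M (x - t))%R)//.
  - by rewrite -EFinB opprK addrC subr0.
  - apply: continuous_in_subspaceT => t; rewrite inE/= in_itv/= => tb.
    exact: cont_mt.
  - split.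
    + move=> t; rewrite in_itv/= => /andP[t0 tb].
      have /dF[//] : (0 <= t <= b)%R by rewrite !ltW.
    + by apply: cvg_at_right_filter; apply: cont_F; rewrite lexx ltW.
    + by apply: cvg_at_left_filter; apply: cont_F; rewrite lexx ltW.
  - move=> t; rewrite in_itv/= => /andP[t0 tb].
    by rewrite derive1E; have [|_ ->] := dF t _; rewrite ?ltW//.
apply/measurable_EFinP; apply: open_continuous_measurable_fun => // t.
by rewrite inE/= in_itv/= => /andP[t0 tb]; apply: cont_mt; rewrite !ltW.
Qed.

End Transfer.

(** * Comparison of the partial sums with super- and subsolutions *)

Section Sandwich.
Variable R : realType.
Implicit Types (x y t u v kappa : R) (n : nat).
Local Open Scope ereal_scope.

(** The length of the interval from [max(0, x - 1)] to [min(1, x - v)]. The outer maximum covers the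
    case where it is empty. *)
Definition gap v x : R :=
  (Num.max 0 (Num.min 1 (x - v) - Num.max 0 (x - 1)))%R.

Definition first_mass v x : \bar R :=
  lebesgue_measure (`]0%R, 1%R[ `&` `](x - 1)%R, (x - v)%R[).

(** This is [T^n g]; it belongs to [n + 1] coordinates, hence the exponent [i.+1] in [mass_sum]. *)
Definition mass v n : R -> \bar R := iter n (@transfer R) (first_mass v).

Lemma first_massE v x : first_mass v x = (gap v x)%:E.
Proof.
rewrite /gap /first_mass -set_itvI/= lebesgue_measure_itv/=.
rewrite meetEtotal joinEtotal lte_fin -EFinB.
case: ltP => [ab|ba]; congr EFin.
  by apply/esym/max_r; rewrite subr_ge0 ltW.
by apply/esym/max_l; rewrite subr_le0.
Qed.

Lemma measurable_first_mass v : measurable_fun setT (first_mass v).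
Proof.
rewrite (_ : first_mass v = EFin \o gap v); last first.
  by apply/funext => x; exact: first_massE.
apply/measurable_EFinP; apply: measurable_maxr => //.
apply: measurable_funB; [apply: measurable_minr|apply: measurable_maxr] => //;
  exact: measurable_funB.
Qed.

Lemma mass_ge0 v n x : 0 <= mass v n x.
Proof. by elim: n x => [|n IH] x; [exact: measure_ge0|exact: transfer_ge0]. Qed.

Lemma measurable_mass v n : measurable_fun setT (mass v n).
Proof.
elim: n => [|n IH]; first exact: measurable_first_mass.
by apply: measurable_transfer => //; exact: mass_ge0.
Qed.

Definition mass_sum kappa v n x : \bar R :=
  \sum_(i < n) (kappa ^+ i.+1)%:E * mass v i x.

Lemma mass_sum_ge0 kappa v n x : (0 <= kappa)%R -> 0 <= mass_sum kappa v n x.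
Proof.
by move=> k0; apply: sume_ge0 => i _; rewrite mule_ge0 ?mass_ge0// lee_fin exprn_ge0.
Qed.

Lemma measurable_mass_sum kappa v n : measurable_fun setT (mass_sum kappa v n).
Proof.
apply: emeasurable_sum => i; apply: measurable_funeM; exact: measurable_mass.
Qed.

(** The term [i = 0] gives the first summand; one factor [kappa] and one [T] come out of all the
    others. *)
Lemma mass_sumS kappa v n x : (0 <= kappa)%R ->
  mass_sum kappa v n.+1 x =
  kappa%:E * first_mass v x + kappa%:E * transfer (mass_sum kappa v n) x.
Proof.
move=> k0; rewrite /mass_sum big_ord_recl/= expr1; congr (_ + _).
pose f i y := (kappa ^+ i.+1)%:E * mass v i y.
have mf i : measurable_fun setT (f i).
  by apply: measurable_funeM; exact: measurable_mass.
have f0 i y : 0 <= f i y by rewrite mule_ge0 ?mass_ge0// lee_fin exprn_ge0.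
rewrite (transfer_sum n x mf f0).
rewrite ge0_sume_distrr; last first.
  by move=> i _; exact: transfer_ge0.
apply: eq_bigr => i _; rewrite transferZ ?exprn_ge0//.
- by rewrite muleA -EFinM -exprS.
- exact: measurable_mass.
- by move=> y; exact: mass_ge0.
Qed.

(** Induction on [n] by positivity of [T]: only the supersolution inequality for [H] enters. *)
Lemma mass_sum_le kappa v u (H : R -> \bar R) n : (0 <= kappa)%R ->
  measurable_fun setT H -> (forall x, (1 <= x <= u)%R -> 0 <= H x) ->
  (forall x, (1 <= x <= u)%R ->
     kappa%:E * first_mass v x + kappa%:E * transfer H x <= H x) ->
  forall x, (1 <= x <= u)%R -> mass_sum kappa v n x <= H x.
Proof.
move=> k0 mH H0 HH; elim: n => [|n IH] x xu.
  by rewrite /mass_sum big_ord0; exact: H0.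
rewrite mass_sumS// (le_trans _ (HH _ xu))// leeD2l// lee_wpmul2l ?lee_fin//.
move: xu => /andP[x1 xu].
apply: le_transfer => // [|y _|y /andP[y1 yx]]; first exact: measurable_mass_sum.
  exact: mass_sum_ge0.
by apply: IH; apply/andP; split; lra.
Qed.

(** With [l = 2 kappa] the left side is [kappa / l] times [x^l - max(1, x - 1)^l]. The exponent is
    chosen to make [kappa / l = 1 / 2], a contraction factor whatever [kappa] is. *)
Lemma transfer_powR kappa x : (0 < kappa)%R -> (1 <= x)%R ->
  kappa%:E * transfer (fun y => (y `^ (2 * kappa))%:E) x <=
  (x `^ (2 * kappa) / 2)%:E.
Proof.
move=> k0 x1; pose l := (2 * kappa)%R.
have l0 : (0 < l)%R by rewrite /l; lra.
rewrite (@eq_transfer _ _ (fun y => (y * y `^ (l - 1))%:E)); last first.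
  by move=> y /andP[y1 _]; rewrite mulr_powRB1//; lra.
have cm (y : R) : (0 < y)%R -> {for y, continuous (fun y => y `^ (l - 1))%R}.
  move=> y0; apply: differentiable_continuous; apply/derivable1_diffP.
  by apply: derivable_powR; rewrite in_itv/= y0.
have dM (y : R) : (0 < y)%R ->
    is_derive y 1%R (fun y => l^-1 * y `^ l)%R (y `^ (l - 1))%R.
  move=> y0; have -> : (y `^ (l - 1) = l^-1 * (l * y `^ (l - 1)))%R.
    by rewrite mulKf ?gt_eqF.
  exact: (is_deriveZ l^-1%R (is_derive1_powR l y0)).
rewrite (transfer_primitive x1 cm dM).
rewrite -EFinM lee_fin -/l.
have p0 : (0 <= Num.max 1 (x - 1) `^ l)%R by exact: powR_ge0.
have -> : (x `^ l / 2 = kappa * (l^-1 * x `^ l))%R by rewrite /l; field; lra.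
apply: ler_wpM2l; first exact: ltW.
by rewrite gerBl mulr_ge0// invr_ge0 ltW.
Qed.

(* [d] bounds the defect of [H] in the equation, and [E] dominates the sum of the
   iterates of [kappa T] on [d]. *)
Lemma le_mass_sum kappa v u (H E d : R -> R) c n : (0 < kappa)%R ->
  measurable_fun setT H -> measurable_fun setT E ->
  (forall x, 0 <= E x)%R ->
  (forall x, (1 <= x <= u)%R -> (0 <= H x <= c * x `^ (2 * kappa))%R) ->
  (forall x, (1 <= x <= u)%R ->
    (H x)%:E <= kappa%:E * first_mass v x +
                kappa%:E * transfer (EFin \o H) x + (d x)%:E) ->
  (forall x, (1 <= x <= u)%R ->
    (d x)%:E + kappa%:E * transfer (EFin \o E) x <= (E x)%:E) ->
  forall x, (1 <= x <= u)%R ->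
    (H x)%:E <= mass_sum kappa v n x + (E x)%:E +
                (c / 2 ^+ n * x `^ (2 * kappa))%:E.
Proof.
move=> k0 mH mE E0 HB HH HE.
elim: n => [|n IH] x /[dup] xu /andP[x1 ux].
  rewrite /mass_sum big_ord0 add0e -EFinD lee_fin expr0 divr1.
  by have /andP[_ /le_trans] := HB _ xu; apply; rewrite lerDr.
have c0 : (0 <= c)%R.
  have /HB : (1 <= (1 : R) <= u)%R by rewrite lexx (le_trans x1).
  by rewrite powR1 mulr1 => /andP[]; exact: le_trans.
(* The error at stage [n]; one application of [kappa T] halves it, which is the bound [TB] below. *)
pose B y := (c / 2 ^+ n * y `^ (2 * kappa))%R.
have B0 y : (0 <= B y)%R by rewrite mulr_ge0 ?powR_ge0// divr_ge0 ?exprn_ge0.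
have mB : measurable_fun setT B.
  by apply: measurable_funM => //; exact: measurable_powR.
have mS := @measurable_mass_sum kappa v n.
have S0 y := @mass_sum_ge0 kappa v n y (ltW k0).
have TH : transfer (EFin \o H) x <= transfer (mass_sum kappa v n) x +
    transfer (EFin \o E) x + transfer (EFin \o B) x.
  have mE' : measurable_fun setT (EFin \o E) by exact/measurable_EFinP.
  have mB' : measurable_fun setT (EFin \o B) by exact/measurable_EFinP.
  have mSE := emeasurable_funD mS mE'.
  rewrite -(transferD _ mS mE')//.
  rewrite -(transferD _ mSE mB'); last 2 first.
  - by move=> y; rewrite adde_ge0 ?lee_fin.
  - by move=> y; rewrite lee_fin.
  apply: le_transfer.
  - exact/measurable_EFinP.
  - exact: emeasurable_funD.
  - move=> y /andP[y1 yx]; rewrite lee_fin.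
    by have /andP[] : (0 <= H y <= c * y `^ (2 * kappa))%R by apply: HB; lra.
  - by move=> y /andP[y1 yx]; apply: IH; lra.
have TB : kappa%:E * transfer (EFin \o B) x <= (c / 2 ^+ n.+1 * x `^ (2 * kappa))%:E.
  rewrite [transfer _ _](_ : _ =
      (c / 2 ^+ n)%:E * transfer (fun y => (y `^ (2 * kappa))%:E) x).
    rewrite muleCA (_ : c / 2 ^+ n.+1 * x `^ (2 * kappa) =
      c / 2 ^+ n * (x `^ (2 * kappa) / 2))%R; last first.
      by rewrite exprSr; field; rewrite expf_neq0.
    rewrite (EFinM (c / 2 ^+ n)) lee_wpmul2l ?transfer_powR//.
    by rewrite lee_fin divr_ge0 ?exprn_ge0.
  rewrite -transferZ//.
  - by apply/measurable_EFinP; exact: measurable_powR.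
  - by move=> y; rewrite lee_fin powR_ge0.
  - by rewrite divr_ge0 ?exprn_ge0.
apply: (le_trans (HH _ xu)); rewrite (mass_sumS _ _ _ (ltW k0)).
have kE : 0 <= kappa%:E by rewrite lee_fin ltW.
have {TH} := lee_wpmul2l kE TH.
have TS0 : 0 <= transfer (mass_sum kappa v n) x by exact: transfer_ge0.
have TE0 : 0 <= transfer (EFin \o E) x by apply: transfer_ge0 => y; rewrite lee_fin.
have TB0 : 0 <= transfer (EFin \o B) x by apply: transfer_ge0 => y; rewrite lee_fin.
rewrite (ge0_muleDr _ (adde_ge0 TS0 TE0) TB0) (ge0_muleDr _ TS0 TE0) => TH.
have {}TH := leeD2l (kappa%:E * first_mass v x) TH.
have {}TH := leeD2r (d x)%:E TH.
apply: (le_trans TH).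
(* Regrouping puts the defect [d] next to [kappa T E], and the hypothesis on [E] absorbs both into
   [E]. *)
rewrite (_ : _ + _ + (d x)%:E = kappa%:E * first_mass v x +
    kappa%:E * transfer (mass_sum kappa v n) x +
    ((d x)%:E + kappa%:E * transfer (EFin \o E) x) +
    kappa%:E * transfer (EFin \o B) x).
  by apply: leeD => //; apply: leeD2l; exact: HE.
rewrite [(d x)%:E + _]addeC -!addeA; congr (_ + (_ + (_ + _))); exact: addeC.
Qed.

End Sandwich.

(** * The multiple integrals as iterates of [T] *)

Section Multiple_integral.
Variable R : realType.
Implicit Types (x y u v kappa : R) (k n : nat).

Lemma partial_sum_cons (a : R) (s : seq R) n :
  partial_sum (a :: s) n.+1 = a + partial_sum s n.
Proof. by rewrite /partial_sum big_nat_recl. Qed.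

Lemma fk_cons x (a : R) (s : seq R) n :
  fk n.+1 x (a :: s) = (x - a)^-1 * fk n (x - a) s.
Proof.
rewrite /fk big_add1/= big_nat_recl// partial_sum_cons [partial_sum s 0]big_geq//.
rewrite addr0; congr (_ * _); rewrite big_add1/=.
by apply: eq_bigr => i _; rewrite partial_sum_cons opprD addrA.
Qed.

(** Every condition on the sums involves only their difference with [x], so removing [t_1 = a]
    shifts [x] to [x - a] and keeps [v]. Starting from at least two coordinates makes the
    predecessor in [partial_sum t k.-1] drop a genuine coordinate. *)
Lemma Vk_cons k x v (a : R) (t : k.+1.-tuple (measurableTypeR R)) :
  Vk k.+2 x v (tuple_cons (a, t)) <-> 0 < a < 1 /\ Vk k.+1 (x - a) v t.
Proof.
rewrite /Vk/= !partial_sum_cons; split.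
  move=> [ti h1 /andP[h2 h3]]; split; first by have := ti ord0; rewrite tnth0.
  split; [|lra|apply/andP; split; lra].
  by move=> i; have := ti (lift ord0 i); rewrite tnthS.
move=> [a01 [ti h1 /andP[h2 h3]]]; split; [|lra|apply/andP; split; lra].
by move=> i; case: (unliftP ord0 i) => [j|] ->; rewrite ?tnthS// tnth0.
Qed.

Lemma Vk_gt1 k x v (t : k.+1.-tuple (measurableTypeR R)) : Vk k.+1 x v t -> 1 < x.
Proof.
move=> [ti /= h1 _]; rewrite -subr_gt0; apply: le_lt_trans h1.
rewrite /partial_sum big_nat; apply: sumr_ge0 => i /andP[_ ik].
have ik1 : (i < k.+1)%N by rewrite ltnS ltnW.
by have /andP[/ltW] := ti (Ordinal ik1); rewrite (tnth_nth 0).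
Qed.

Lemma measurable_tuple_nth k j :
  measurable_fun setT (fun t : k.-tuple (measurableTypeR R) => t`_j : R).
Proof.
have [jk|kj] := ltnP j k.
  rewrite (_ : (fun _ => _) = (fun t : k.-tuple (measurableTypeR R) =>
    tnth t (Ordinal jk))); first exact: measurable_tnth.
  by apply/funext => t; rewrite (tnth_nth 0).
rewrite (_ : (fun _ => _) = cst 0); first exact: measurable_cst.
by apply/funext => t; rewrite nth_default// size_tuple.
Qed.

Lemma measurable_partial_sum k j :
  measurable_fun setT (fun t : k.-tuple (measurableTypeR R) => partial_sum t j).
Proof. by apply: measurable_sum => i; exact: measurable_tuple_nth. Qed.

Lemma measurable_fk k j x :
  measurable_fun setT (fun t : k.-tuple (measurableTypeR R) => fk j x t).
Proof.
apply: measurable_prod => i _; apply: (measurableT_comp (@measurable_inv R)).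
by apply: measurable_funB; [exact: measurable_cst|exact: measurable_partial_sum].
Qed.

Lemma measurable_Vk k x v : measurable (Vk k x v).
Proof.
have mlt (f g : k.-tuple (measurableTypeR R) -> R) :
    measurable_fun setT f -> measurable_fun setT g ->
    measurable [set t | f t < g t].
  move=> mf mg; have := measurable_fun_ltr mf mg.
  by move=> /(_ measurableT [set true] I); rewrite setTI.
rewrite (_ : Vk k x v = \bigcap_(i in [set: 'I_k])
    ([set t | 0 < tnth t i] `&` [set t | tnth t i < 1]) `&`
  [set t : k.-tuple (measurableTypeR R) | partial_sum t k.-1 < x - 1] `&`
  ([set t : k.-tuple (measurableTypeR R) | x - 1 < partial_sum t k] `&`
   [set t : k.-tuple (measurableTypeR R) | partial_sum t k < x - v])); last first.
  apply/seteqP; split=> t.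
    move=> [ti h1 /andP[h2 h3]]; split=> //; split=> // i _.
    by have /andP[] := ti i.
  move=> [[ti h1] [h2 h3]]; split=> //; last exact/andP.
  by move=> i; have [] := ti i I => *; exact/andP.
apply: measurableI; first apply: measurableI.
- apply: fin_bigcap_measurable; first exact: finite_finset.
  by move=> i _; apply: measurableI; apply: mlt => //; exact: measurable_tnth.
- by apply: mlt => //; exact: measurable_partial_sum.
- by apply: measurableI; apply: mlt => //; exact: measurable_partial_sum.
Qed.

Local Open Scope ereal_scope.

(** The measure is a pushforward of a product: change variables, then apply Tonelli. *)
Lemma integral_lebesgue_tupleS n (f : n.+1.-tuple (measurableTypeR R) -> \bar R) :
  measurable_fun setT f -> (forall t, 0 <= f t) ->
  \int[lebesgue_tuple R n.+1]_t f t =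
  \int[lebesgue_measure]_a
    \int[lebesgue_tuple R n]_t f (tuple_cons (a, t)).
Proof.
move=> mf f0; rewrite /= /cons_measure ge0_integral_pushforward//; last first.
  exact: measurable_tuple_cons.
rewrite preimage_setT fubini_tonelli1//=.
by apply: measurableT_comp => //; exact: measurable_tuple_cons.
Qed.

(** Extension by zero to all tuples, the form in which Tonelli applies. *)
Definition Vk_integrand k x v : k.+1.-tuple (measurableTypeR R) -> \bar R :=
  (fun t => (fk k x t)%:E) \_ (Vk k.+1 x v).
Arguments Vk_integrand : clear implicits.
Local Notation F := Vk_integrand.

Let F_cons k x v a t : F k.+1 x v (tuple_cons (a, t)) =
  if (0 < a < 1)%R then ((x - a)^-1)%:E * F k (x - a)%R v t else 0.
Proof.
rewrite /Vk_integrand !patchE; case: ifPn => [|V].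
  by rewrite inE => /Vk_cons[-> Vt]; rewrite mem_set// fk_cons EFinM.
case: ifP => // a01; rewrite memNset ?mule0// => Vt.
by move: V; rewrite notin_setE; apply; exact/Vk_cons.
Qed.

(** The product [fk] may be negative off [Vk]. Inside, each peeled factor has [x - a > 1], because
    the remaining coordinates lie in a nonempty domain for [x - a]. *)
Let F_ge0 k x v t : 0 <= F k x v t.
Proof.
elim: k x t => [|k IH] x t.
  by rewrite /Vk_integrand patchE; case: ifP => // _; rewrite /fk big_geq// lee_fin.
rewrite (_ : t = tuple_cons (thead t, [tuple of behead t])); last first.
  by apply/val_inj; rewrite {1}(tuple_eta t).
rewrite F_cons; case: ifPn => // _.
rewrite {1}/Vk_integrand patchE; case: ifPn => [Vt|]; last by rewrite mule0.
rewrite mule_ge0//.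
  by move: Vt; rewrite inE => /Vk_gt1 ?; rewrite lee_fin invr_ge0; lra.
by have := IH (x - thead t)%R [tuple of behead t]; rewrite /Vk_integrand patchE Vt.
Qed.

Let measurable_F k x v : measurable_fun setT (F k x v).
Proof.
apply/(measurable_restrictT _ _).1; first exact: measurable_Vk.
by apply: measurable_funTS; apply/measurable_EFinP; exact: measurable_fk.
Qed.

(** Induction on [k], integrating over [t_1] last. The guard is there because the domain is empty
    for [x <= 1], while [mass v 0 x] can be positive there. *)
Lemma integral_Vk k x v :
  \int[lebesgue_tuple R k.+1]_(t in Vk k.+1 x v) (fk k x t)%:E =
  if (1 < x)%R then mass v k x else 0.
Proof.
elim: k x => [|k IH] x.
  rewrite (eq_integral (cst 1)); last by move=> t _; rewrite /fk big_geq.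
  rewrite integral_cst; last exact: measurable_Vk.
  rewrite mul1e; case: ifPn => x1; last first.
    rewrite (_ : Vk 1 x v = set0) ?measure0// -subset0 => t /Vk_gt1.
    exact/negP.
  pose A : 'I_1 -> set (measurableTypeR R) :=
    fun=> `]0%R, 1%R[ `&` `](x - 1)%R, (x - v)%R[.
  have mA i : measurable (A i) by exact: measurableI.
  rewrite /mass/= -[RHS](_ : \prod_(i < 1) lebesgue_measure (A i) = _); last first.
    by rewrite big_ord1.
  rewrite -lebesgue_tuple_box//; congr (lebesgue_tuple R 1 _).
  have ps1 (t : 1.-tuple (measurableTypeR R)) : partial_sum t 1 = tnth t ord0.
    by rewrite /partial_sum big_nat1 (tnth_nth 0%R).
  apply/seteqP; split=> t; rewrite /Vk/= ps1.
    move=> [ti _ h] i; rewrite (ord1 i); split; rewrite /= in_itv/= ?h//.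
  move=> At; have [] := At ord0; rewrite /= !in_itv/= => h1 h2; split => //.
    by move=> i; rewrite (ord1 i).
  by rewrite /partial_sum big_geq// subr_gt0.
transitivity (\int[lebesgue_tuple R k.+2]_t F k.+1 x v t).
  by rewrite integral_mkcond.
rewrite integral_lebesgue_tupleS; [|exact: measurable_F|exact: F_ge0].
transitivity (\int[@lebesgue_measure R]_a
    (if (0 < a < 1)%R then ((x - a)^-1)%:E *
       (if (1 < x - a)%R then mass v k (x - a)%R else 0) else 0)).
  apply: eq_integral => a _.
  under eq_integral do rewrite F_cons.
  case: ifPn => a01; last exact: integral0.
  case: ifPn => xa.
    rewrite ge0_integralZl//; last 2 first.
    - exact: measurable_F.
    - by rewrite lee_fin invr_ge0; lra.
    by rewrite -integral_mkcond IH xa.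
  rewrite mule0 integral0_eq// => t _.
  rewrite /Vk_integrand patchE memNset ?mule0// => /Vk_gt1.
  exact/negP.
rewrite /= -/(mass v k) /transfer.
case: ifPn => x1.
  rewrite [RHS]integral_mkcond.
  (* The guard [1 < x - a] together with [a < 1] gives the upper limit [min(1, x - 1)] of the
     transfer integral. *)
  apply: eq_integral => a _; rewrite patchE mem_setE in_itv/= lt_min.
  rewrite (_ : (a < x - 1)%R = (1 < x - a)%R); last by apply/idP/idP; lra.
  by case: (0 < a)%R; case: (a < 1)%R; case: (1 < x - a)%R => //=; rewrite mule0.
apply: integral0_eq => a _; case: ifPn => // a01; rewrite ifF ?mule0//.
by apply/negbTE; move: x1; rewrite -!leNgt; lra.
Qed.

Lemma muk_mass k u v : (1 <= u)%R -> muk k.+1 u v = (u^-1)%:E * mass v k u.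
Proof.
move=> u1; case: k => [|k]; first by [].
rewrite /muk/= integral_Vk; congr (_ * _); case: ifPn => //; rewrite -leNgt => u1'.
(* At [u = 1] the guard fails, and the transfer integral vanishes too, being over []0, 0[]. *)
have -> : u = 1%R by apply/eqP; rewrite eq_le u1' u1.
by rewrite /mass/= /transfer subrr min_r// set_itvE integral_set0.
Qed.

Lemma mu_series_mass kappa u v : (0 <= kappa)%R -> (1 <= u)%R ->
  mu_series kappa u v =
  (u^-1)%:E * \sum_(0 <= i <oo) (kappa ^+ i.+1)%:E * mass v i u.
Proof.
move=> k0 u1; rewrite /mu_series -(nneseries_addn 1); last first.
  have uV0 : 0 <= (u^-1)%:E by rewrite lee_fin invr_ge0; lra.
  case=> [|i]; last first.
    by rewrite muk_mass// mule_ge0 ?lee_fin ?exprn_ge0// mule_ge0// mass_ge0.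
  (* The index [0] lies outside the sum, but the shift of indices asks for nonnegative terms from
     there on; [fk 0] is an empty product. *)
  rewrite mule_ge0//; apply: mule_ge0 => //; apply: integral_ge0 => t _.
  by rewrite /fk big_geq// lee_fin.
rewrite -nneseriesZl; last first.
  by move=> i *; rewrite mule_ge0 ?mass_ge0 ?lee_fin ?exprn_ge0.
by apply: eq_eseriesr => i _; rewrite addn1 muk_mass// muleCA.
Qed.

Lemma mass_series_le kappa u v (h : \bar R) : (0 <= kappa)%R ->
  (forall n, mass_sum kappa v n u <= h) ->
  \sum_(0 <= i <oo) (kappa ^+ i.+1)%:E * mass v i u <= h.
Proof.
move=> k0 hS; apply: lime_le.
  by apply: is_cvg_nneseries => i _ _; rewrite mule_ge0 ?mass_ge0 ?lee_fin ?exprn_ge0.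
by apply: nearW => n; rewrite big_mkord; exact: hS.
Qed.

(** Partial sums are at most the full sum, and for any [d > 0] some [n] makes the last term smaller
    than [d]. *)
Lemma le_mass_series kappa u v (h b e : R) : (0 <= kappa)%R -> 
  (forall n, h%:E <= mass_sum kappa v n u + e%:E + (b / 2 ^+ n)%:E) ->
  h%:E <= \sum_(0 <= i <oo) (kappa ^+ i.+1)%:E * mass v i u + e%:E.
Proof.
move=> k0 hS; set s := \sum_(0 <= i <oo) _.
have b2 : (b / 2 ^+ n)%R @[n --> \oo] --> (0 : R)%R.
  rewrite -(mulr0 b); apply: cvgMr => /=.
  under eq_fun do rewrite -exprVn.
  by apply: cvg_expr; rewrite ger0_norm; lra.
apply/lee_addgt0Pr => d d0.
have /cvgrPdist_lt/(_ _ d0)[n _ /(_ n (leqnn n))/=] := b2.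
rewrite sub0r normrN => bd; apply: (le_trans (hS n)); apply: leeD.
  apply: leeD2r; rewrite /mass_sum -(big_mkord xpredT
    (fun i => (kappa ^+ i.+1)%:E * mass v i u)).
  by apply: nneseries_lim_ge => i _ _; rewrite mule_ge0 ?mass_ge0 ?lee_fin ?exprn_ge0.
by rewrite lee_fin; apply/ltW; exact: le_lt_trans (ler_norm _) bd.
Qed.

End Multiple_integral.

(** * From the delay equation for [m] to values of the series *)

Section Delay_equation.
Variable R : realType.
Implicit Types (x y u v kappa c : R) (m M E d : R -> R).

Lemma gap_ge0 v x : 0 <= gap v x.
Proof. by rewrite le_max lexx. Qed.

Lemma gap_cst v x : v <= 1 -> 1 <= x <= 1 + v -> gap v x = 1 - v.
Proof.
move=> v1 /andP[x1 xv]; rewrite /gap (max_r (_ : 0 <= x - 1)) ?min_r; try lra.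
by rewrite max_r; lra.
Qed.

Lemma gap_lin v x : 0 <= v -> 1 + v <= x <= 2 -> gap v x = 2 - x.
Proof.
move=> v0 /andP[xv x2]; rewrite /gap (max_r (_ : 0 <= x - 1)) ?min_l; try lra.
by rewrite max_r; lra.
Qed.

Lemma gap_eq0 v x : v <= 1 -> 2 <= x -> gap v x = 0.
Proof.
move=> v1 x2; rewrite /gap (max_r (_ : 0 <= x - 1)) ?min_l; try lra.
by rewrite max_l; lra.
Qed.

Lemma gap_le v x : 0 <= v <= 1 -> 1 <= x -> gap v x <= gap 0 x.
Proof.
move=> /andP[v0 v1] x1; have [x2|x2] := leP 2 x; first by rewrite !gap_eq0.
rewrite (@gap_lin 0 x) ?lexx ?addr0; [|by []|by rewrite x1 ltW].
have [xv|xv] := leP x (1 + v); first by rewrite gap_cst ?x1//; lra.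
by rewrite gap_lin ?(ltW xv) ?(ltW x2)//; lra.
Qed.

(** The two gaps differ by [1 + v - x <= v] on [[1, 1 + v]] and agree beyond. The cutoff
    [2 >= 1 + v] does not depend on [v]. *)
Lemma le_gap v x : 0 <= v <= 1 -> 1 <= x ->
  gap 0 x <= gap v x + (if x <= 2 then v else 0).
Proof.
move=> /andP[v0 v1] x1; case: (leP x 2) => x2; last first.
  by rewrite !gap_eq0 ?addr0 ?(ltW x2).
rewrite (@gap_lin 0 x) ?lexx ?addr0; [|by []|by rewrite x1].
have [xv|xv] := leP x (1 + v); first by rewrite gap_cst ?x1//; lra.
by rewrite gap_lin ?(ltW xv)//; lra.
Qed.

(** The value at [x] of [T] on [y m(y)], when [M] is a primitive of [m]. *)
Definition transition x (M : R -> R) := M x - M (Num.max 1 (x - 1)).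

Lemma continuous_pos_within m u : (forall y, 0 < y -> {for y, continuous m}) ->
  {within `[1, u], continuous m}.
Proof.
move=> cm; apply: continuous_in_subspaceT => y; rewrite inE/= in_itv/= => /andP[y1 _].
by apply: cm; lra.
Qed.

Lemma derivable_pos_continuous m M : (forall y : R, 0 < y -> is_derive y 1 M (m y)) ->
  forall y : R, 0 < y -> {for y, continuous M}.
Proof. by move=> dM y /dM[+ _]; move/derivable1_diffP; exact: differentiable_continuous. Qed.

(* At a minimum [p] of [m], the equation reads
   [p m(p) >= (p - max(1, p - 1)) m(p)]. *)
Lemma delay_ge0 m M (g : R -> R) u :
  (forall y : R, 0 < y -> {for y, continuous m}) ->
  (forall y : R, 0 < y -> is_derive y 1 M (m y)) ->
  (forall x, 0 <= g x) ->
  (forall x, 1 <= x <= u -> x * m x = g x + transition x M) ->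
  forall x, 1 <= x <= u -> 0 <= m x.
Proof.
move=> cm dM g0 eqm x /andP[x1 xu]; have u1 := le_trans x1 xu.
have [p] := EVT_min u1 (continuous_pos_within cm).
rewrite in_itv/= => pu minp.
apply: (@le_trans _ _ (m p)); last by apply: minp; rewrite in_itv/= x1.
have /andP[p1 pu'] := pu.
pose q := Num.max 1 (p - 1).
have q1 : 1 <= q by rewrite le_max lexx.
have qp : q <= p by rewrite ge_max p1/=; lra.
have [c|| c] := @MVT_segment R M m q p qp.
- by rewrite in_itv/= => /andP[qc _]; apply: dM; lra.
- apply: continuous_in_subspaceT => y; rewrite inE/= in_itv/= => /andP[y1 _].
  by apply: (derivable_pos_continuous dM); lra.
rewrite in_itv/= => /andP[qc cp] Mpq.
have := eqm _ pu; rewrite /transition -/q Mpq => eqp.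
(* The mean value theorem has turned the transition term into [m(c) (p - q)]. As [m(c) >= m(p)], the
   equation yields [q m(p) >= 0] with [q >= 1]. *)
have mpc : m p <= m c by apply: minp; rewrite in_itv/=; apply/andP; split; lra.
have := g0 p; nra.
Qed.

(** The sandwich applied to [H(y) = y m(y)] and divided by [u]: [m] may be a supersolution that is a
    subsolution only up to the defect [d], at the cost of [E(u) / u]. *)
Lemma mu_series_bounds kappa u v m M E d :
  0 < kappa -> 1 <= u ->
  measurable_fun setT m -> measurable_fun setT E -> (forall x, 0 <= E x) ->
  (forall y : R, 0 < y -> {for y, continuous m}) ->
  (forall y : R, 0 < y -> is_derive y 1 M (m y)) ->
  (forall x, 1 <= x <= u -> 0 <= m x) ->
  (forall x, 1 <= x <= u -> kappa * gap v x + kappa * transition x M <= x * m x) ->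
  (forall x, 1 <= x <= u ->
    x * m x <= kappa * gap v x + kappa * transition x M + d x) ->
  (forall x, 1 <= x <= u ->
    ((d x)%:E + kappa%:E * transfer (EFin \o E) x <= (E x)%:E)%E) ->
  (mu_series kappa u v <= (m u)%:E)%E /\
  ((m u)%:E <= mu_series kappa u v + (E u / u)%:E)%E.
Proof.
move=> k0 u1 mm mE E0 cm dM m0 up low dE.
pose H y := y * m y.
have mH : measurable_fun setT H by apply: measurable_funM.
have H0 x : 1 <= x <= u -> 0 <= H x.
  by move=> /[dup] /m0 ? /andP[? _]; rewrite mulr_ge0//; lra.
have TH x : 1 <= x -> transfer (EFin \o H) x = (transition x M)%:E.
  by move=> x1; exact: transfer_primitive.
have k0' := ltW k0.
have u0 : 0 < u by lra.
rewrite mu_series_mass//; set S := (\sum_(0 <= _ <oo) _)%E.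
have upS : (S <= (H u)%:E)%E.
  apply: mass_series_le => // n.
  apply: (@mass_sum_le _ kappa v u (EFin \o H)); rewrite ?lexx ?u1//.
  - exact/measurable_EFinP.
  - move=> x xu; rewrite TH; last by case/andP: xu.
    by rewrite first_massE -!EFinM -EFinD lee_fin; exact: up.
have cH (y : R) : 0 < y -> {for y, continuous H}.
  by move=> y0; apply: cvgM; [exact: cvg_id|exact: cm].
(* The maximum of [H] on [[1, u]] serves as the constant in [H <= c x^(2 kappa)], since the power is
   at least [1] there. *)
have [p] := EVT_max u1 (@continuous_pos_within H u cH).
rewrite in_itv/= => pu maxp.
have lowS : ((H u)%:E <= S + (E u)%:E)%E.
  apply: (@le_mass_series _ kappa u v (H u) (H p * u `^ (2 * kappa)) (E u)) => // n.
  rewrite mulrAC.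
  apply: (@le_mass_sum _ kappa v u H E d) => //; last by rewrite lexx u1.
  - move=> x xu; rewrite H0//=; apply: (@le_trans _ _ (H p)).
      by apply: maxp; rewrite in_itv.
    rewrite ler_peMr ?H0//; case/andP: xu => x1 _.
    have k2 : 0 <= 2 * kappa by lra.
    by have := ler_powR x1 k2; rewrite powRr0.
  - move=> x xu; rewrite TH; last by case/andP: xu.
    by rewrite first_massE -!EFinM -!EFinD lee_fin; exact: low.
have uV0 : (0 <= (u^-1)%:E)%E by rewrite lee_fin invr_ge0 ltW.
have mE' : (m u)%:E = ((u^-1)%:E * (H u)%:E)%E.
  by rewrite -EFinM /H mulKf// gt_eqF.
have S0 : (0 <= S)%E.
  by apply: nneseries_ge0 => i *; rewrite mule_ge0 ?mass_ge0 ?lee_fin ?exprn_ge0.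
rewrite mE'; split; first exact: lee_wpmul2l.
rewrite (_ : (E u / u)%:E = (u^-1)%:E * (E u)%:E)%E; last first.
  by rewrite -EFinM mulrC.
by rewrite -ge0_muleDr ?lee_fin//; exact: lee_wpmul2l.
Qed.

Lemma mu_series_solution kappa u v m M :
  0 < kappa -> 1 <= u -> measurable_fun setT m ->
  (forall y : R, 0 < y -> {for y, continuous m}) ->
  (forall y : R, 0 < y -> is_derive y 1 M (m y)) ->
  (forall x, 1 <= x <= u -> 0 <= m x) ->
  (forall x, 1 <= x <= u -> x * m x = kappa * gap v x + kappa * transition x M) ->
  mu_series kappa u v = (m u)%:E.
Proof.
move=> k0 u1 mm cm dM m0 eqm.
have [|||||up] := @mu_series_bounds kappa u v m M (cst 0) (cst 0) k0 u1 mm _ _ cm dM m0.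
- exact: measurable_cst.
- by [].
- by move=> x xu; rewrite eqm.
- by move=> x xu; rewrite eqm ?addr0.
- move=> x xu; rewrite add0e [transfer _ _]integral0_eq ?mule0// => t _.
  by rewrite mule0.
by rewrite mul0r adde0 => low; apply/eqP; rewrite eq_le up low.
Qed.

End Delay_equation.

(** * Closed forms for claims (i) and (ii) *)

Section Explicit_solutions.
Variable R : realType.
Implicit Types (x y u v a kappa : R).

(** For [x <= 1 + v] the gap is constant and the lower limit is [1], so differentiating the equation
    gives [x m' = (kappa - 1) m]. The factor [kappa (1 - v)] is the value at [x = 1]. *)
Lemma mu_series_powR kappa u v : 0 < kappa -> 0 <= v <= 1 ->
  1 <= u <= 1 + v ->
  mu_series kappa u v = (kappa * (1 - v) * u `^ (kappa - 1))%:E.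
Proof.
move=> k0 /andP[v0 v1] /andP[u1 uv].
apply: (@mu_series_solution _ kappa u v
  (fun y => kappa * (1 - v) * y `^ (kappa - 1)) (fun y => (1 - v) * y `^ kappa)) => //.
- by apply: measurable_funM => //; exact: measurable_powR.
- move=> y y0; apply: cvgMr.
  suff : {for y, continuous (fun y => y `^ (kappa - 1))} by [].
  apply: differentiable_continuous; apply/derivable1_diffP.
  by apply: derivable_powR; rewrite in_itv/= y0.
- move=> y y0; rewrite [kappa * _]mulrC -mulrA.
  exact: (is_deriveZ (1 - v) (is_derive1_powR kappa y0)).
- by move=> x _; rewrite mulr_ge0 ?powR_ge0// mulr_ge0 ?subr_ge0// ltW.
- move=> x /andP[x1 xu]; rewrite gap_cst//; last by rewrite x1; lra.
  rewrite /transition max_l; last lra.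
  rewrite powR1 mulr1 -(@mulr_powRB1 _ x kappa) //; first by ring.
  by lra.
Qed.

Let phi a y := y * (ln y - ln a) - y.

Let is_derive_phi a y : 0 < y -> is_derive y 1 (phi a) (ln y - ln a).
Proof.
move=> y0.
have dl : is_derive y 1 (fun y => ln y - ln a) (y^-1 - 0).
  exact: (is_deriveB (is_derive1_ln y0) (is_derive_cst (ln a) y 1)).
have dm := is_deriveM (is_derive_id y 1) dl.
have -> : ln y - ln a = y *: (y^-1 - 0) + (ln y - ln a) *: 1 - 1.
  by rewrite /GRing.scale/= subr0 mulfV ?gt_eqF//; ring.
exact: (is_deriveB dm (is_derive_id y 1)).
Qed.

(** The difference quotient of the glued function is [0] on the left of [a] and that of [f] on the
    right; both tend to [0]. *)
Lemma is_derive_max_kink (f : R -> R) a : is_derive a 1 f 0 ->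
  is_derive a 1 (fun x => f (Num.max x a)) 0.
Proof.
move=> [df f'0].
suff cv : h^-1 *: (f (Num.max (h *: 1 + a) a) - f (Num.max a a)) @[h --> 0^'] --> (0 : R).
  by split; [apply/cvg_ex; exists 0|exact/cvg_lim].
have : h^-1 *: (f (h *: 1 + a) - f a) @[h --> 0^'] --> (0 : R).
  by move: df => /cvg_toP; exact.
move=> /cvgrPdist_lt cf; apply/cvgrPdist_lt => e e0.
near=> h.
have : `|0 - h^-1 *: (f (h *: 1 + a) - f a)| < e by near: h; exact: cf.
rewrite maxxx; case: (leP (h *: 1 + a) a) => // _ _.
by rewrite subrr scaler0 subr0 normr0.
Unshelve. all: by end_near.
Qed.

(* [lnp a y] is [max(0, ln (y / a))]. *)
Let lnp a y : R := ln (Num.max y a) - ln a.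
Let Lnp a y : R := phi a (Num.max y a).

(** At the junction [y = a] the derivative [ln y - ln a] of [phi a] vanishes, so the kink is
    harmless. *)
Let is_derive_Lnp a y : 0 < a -> 0 < y -> is_derive y 1 (Lnp a) (lnp a y).
Proof.
move=> a0 y0; rewrite /lnp; case: (ltgtP y a) => [ya|ay|->].
- rewrite subrr; apply: (@near_eq_is_derive _ _ _ (cst (phi a a))).
    near=> z; rewrite /Lnp max_r//; apply/ltW; near: z; exact: lt_nbhsl.
- apply: (@near_eq_is_derive _ _ _ (phi a)); last exact: is_derive_phi.
  by near=> z; rewrite /Lnp max_l//; apply/ltW; near: z; exact: lt_nbhsr.
- rewrite subrr; apply: is_derive_max_kink.
  by have := is_derive_phi a a0; rewrite subrr.
Unshelve. all: by end_near.
Qed.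

Let continuous_lnp a y : 0 < a -> {for y, continuous (lnp a)}.
Proof.
move=> a0; apply: cvgB; last exact: cvg_cst.
apply: (@continuous_comp _ _ _ (fun y => Num.max y a) (@ln R)).
  by apply: continuous_max; [exact: cvg_id|exact: cvg_cst].
by apply: continuous_ln; rewrite lt_max a0 orbT.
Qed.

Let measurable_lnp a : measurable_fun setT (lnp a).
Proof.
apply: measurable_funB; last exact: measurable_cst.
apply: (measurableT_comp (@measurable_ln R)).
by apply: measurable_maxr; [exact: measurable_id|exact: measurable_cst].
Qed.

(** Differentiating the equation piece by piece: [m' = 0] up to [1 + v]; then [x m' = -1] up to [2],
    from the slope of the gap; beyond [2], [x m' = - m(x - 1) = -(1 - v)], because [x - 1 <= 1 + v]
    still lies on the first piece. *)
Lemma mu_series_ln u v : 0 <= v <= 1 -> 1 <= u <= 2 + v ->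
  mu_series 1 u v =
  (1 - v - (ln (Num.max u (1 + v)) - ln (1 + v)) + v * (ln (Num.max u 2) - ln 2))%:E.
Proof.
move=> /andP[v0 v1] /andP[u1 uv]; have v10 : 0 < 1 + v by lra.
pose m y := 1 - v - lnp (1 + v) y + v * lnp 2 y.
pose M y := (1 - v) * y - Lnp (1 + v) y + v * Lnp 2 y.
have cm (y : R) : 0 < y -> {for y, continuous m}.
  move=> y0; apply: cvgD; last by apply: cvgMr; exact: continuous_lnp.
  by apply: cvgB; [exact: cvg_cst|exact: continuous_lnp].
have dM (y : R) : 0 < y -> is_derive y 1 M (m y).
  move=> y0; have -> : m y = (1 - v) * 1 - lnp (1 + v) y + v * lnp 2 y.
    by rewrite mulr1.
  exact: (is_deriveD (is_deriveB (is_deriveZ (1 - v) (is_derive_id y 1))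
    (is_derive_Lnp v10 y0)) (is_deriveZ v (is_derive_Lnp (ltr0Sn _ 1) y0))).
have eqm x : 1 <= x <= u -> x * m x = gap v x + transition x M.
  move=> /andP[x1 xu]; rewrite /transition /m /M /lnp /Lnp /phi.
  have [x2|x2] := leP x 2.
    rewrite (max_l (_ : x - 1 <= 1)); last lra.
    rewrite (max_r (_ : 1 <= 2)) ?ler1n// (max_r (_ : 1 <= 1 + v)); last lra.
    have [xv|xv] := leP x (1 + v).
      by rewrite gap_cst ?x1//; ring.
    by rewrite gap_lin ?(ltW xv)//; ring.
  rewrite (max_r (_ : 1 <= x - 1)); last lra.
  rewrite (max_l (_ : 1 + v <= x)); last lra.
  rewrite (max_r (_ : x - 1 <= 1 + v)); last lra.
  rewrite (max_r (_ : x - 1 <= 2)); last lra.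
  by rewrite gap_eq0 ?(ltW x2)//; ring.
apply: (@mu_series_solution _ 1 u v m M) => //.
- apply: measurable_funD; last by apply: measurable_funM.
  by apply: measurable_funB; [exact: measurable_cst|exact: measurable_lnp].
- exact: (delay_ge0 cm dM (gap_ge0 v) eqm).
- by move=> x xu; rewrite !mul1r; exact: eqm.
Qed.

End Explicit_solutions.

(** * Comparison with Dickman's function *)

Section Dickman.
Variables (R : realType) (rho : R -> R).
Hypothesis rhoP : is_dickman rho.
Implicit Types (x y u v : R).

(** Replacing the arbitrary values of [rho] on negative numbers by [rho 0] gives a function
    continuous on the whole line. *)
Definition clamped x := rho (Num.max x 0).
Local Notation r := clamped.

Lemma clamped_ge0 x : 0 <= x -> r x = rho x.
Proof. by move=> x0; rewrite /clamped max_l. Qed.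

Lemma clamped_le1 x : x <= 1 -> r x = 1.
Proof.
move=> x1; rewrite /clamped; case: rhoP => _ _ -> //.
by rewrite le_max lexx orbT ge_max x1 ler01.
Qed.

Lemma continuous_clamped : continuous r.
Proof.
case: rhoP => /subspace_continuousP crho _ _ _ x.
apply: (@cvg_comp _ _ _ (fun y => Num.max y 0) rho _
  (within `[0, +oo[ (nbhs (Num.max x 0)))); last first.
  by apply: crho; rewrite /= in_itv/= le_max lexx orbT.
have cmax : Num.max y 0 @[y --> x] --> Num.max x 0.
  by apply: continuous_max; [exact: cvg_id|exact: cvg_cst].
move=> P /cmax cP.
have {}cP : \forall y \near x, `[0, +oo[%classic (Num.max y 0) -> P (Num.max y 0).
  exact: cP.
apply: filterS cP => y; apply.
by rewrite /= in_itv/= le_max lexx orbT.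
Qed.

(** Starting at [-1] keeps [0] interior, so that [primitive (x - 1)] is still well behaved at
    [x = 1]. *)
Definition primitive x : R := \int[lebesgue_measure]_(t in `[-1, x]) r t.
Local Notation M := primitive.

Lemma is_derive_primitive (y : R) : -1 < y -> is_derive y 1 M (r y).
Proof.
move=> y1; have yy1 : y < y + 1 by lra.
have [] := @continuous_FTC1 R r (BLeft (-1)) y (y + 1) yy1.
- apply: continuous_compact_integrable; first exact: segment_compact.
  by apply: continuous_subspaceT => z; exact: continuous_clamped.
- by rewrite lte_fin.
- exact: continuous_clamped.
by move=> dM <-; rewrite derive1E; exact: DeriveDef.
Qed.

Lemma continuous_primitive (y : R) : -1 < y -> {for y, continuous M}.
Proof.
by move=> /is_derive_primitive[+ _]; move/derivable1_diffP; exact: differentiable_continuous.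
Qed.

Lemma primitive_le1 (x y : R) : -1 < x <= y -> y <= 1 -> M y - M x = y - x.
Proof.
move=> /andP[x1 xy] y1.
have [c|| c] := @MVT_segment R M r x y xy.
- by rewrite in_itv/= => /andP[xc _]; apply: is_derive_primitive; lra.
- apply: continuous_in_subspaceT => z; rewrite inE/= in_itv/= => /andP[xz _].
  by apply: continuous_primitive; lra.
rewrite in_itv/= => /andP[_ cy] ->; rewrite clamped_le1 ?mul1r//; lra.
Qed.

(** The difference [D] of the two sides vanishes at [1]. On [(1, x)] its derivative is
    [y rho'(y) + rho(y - 1) = 0], and continuity at [1] is enough for the mean value theorem. *)
Lemma dickman_eq x : 1 <= x -> x * r x = M x - M (x - 1).
Proof.
move=> x1; pose D y := y * r y - (M y - M (y - 1)).
have dD (y : R) : 1 < y -> is_derive y 1 D 0.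
  move=> y1; case: rhoP => _ drho _ /(_ _ y1) eqrho.
  have dr : is_derive y 1 r (rho^`()%classic y).
    apply: (@near_eq_is_derive _ _ _ rho).
      near=> z; rewrite clamped_ge0//; apply/ltW; near: z; apply: lt_nbhsr; lra.
    by rewrite derive1E; exact: DeriveDef (drho _ y1) erefl.
  have dB : is_derive y 1 (fun y : R => y - 1) (1 - 0).
    exact: (is_deriveB (is_derive_id y 1) (is_derive_cst (1 : R) y 1)).
  have dMy : is_derive y 1 M (r y) by apply: is_derive_primitive; lra.
  have dMB : is_derive y 1 (fun y : R => M (y - 1)) (r (y - 1) * (1 - 0)).
    apply: (@is_derive1_comp _ M (fun y => y - 1) y _ _ _ dB).
    by apply: is_derive_primitive; lra.
  have -> : (0 : R) = y *: rho^`()%classic y + r y *: 1 - (r y - r (y - 1) * (1 - 0)).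
    rewrite /GRing.scale/= (@clamped_ge0 (y - 1)); last lra.
    by rewrite -[LHS]eqrho; ring.
  exact: (is_deriveB (is_deriveM (is_derive_id y 1) dr) (is_deriveB dMy dMB)).
have D1 : D 1 = 0.
  rewrite /D subrr primitive_le1 ?lexx//; last by apply/andP; split; lra.
  by rewrite clamped_le1//; ring.
have [c|| c] := @MVT_segment R D (cst 0) 1 x x1.
- by rewrite in_itv/= => /andP[xc _]; exact: dD.
- apply: continuous_in_subspaceT => z; rewrite inE/= in_itv/= => /andP[xz _].
  apply: cvgB; first by apply: cvgM; [exact: cvg_id|exact: continuous_clamped].
  apply: cvgB; first by apply: continuous_primitive; lra.
  apply: (@continuous_comp _ _ _ (fun y => y - 1) M).
    by apply: cvgB; [exact: cvg_id|exact: cvg_cst].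
  by apply: continuous_primitive; lra.
rewrite mul0r D1 subr0 /D => _ /eqP; rewrite subr_eq0 => /eqP; exact.
Unshelve. all: by end_near.
Qed.

(** For [x < 2] the lower limit moves from [x - 1] to [1]; the removed integral of [1] has length
    [2 - x], which is the gap for [v = 0]. *)
Lemma dickman_gap x : 1 <= x -> x * r x = gap 0 x + transition x M.
Proof.
move=> x1; rewrite dickman_eq// /transition; case: (leP 1 (x - 1)) => x2.
  by rewrite gap_eq0 ?add0r//; lra.
rewrite gap_lin//; last lra.
have := @primitive_le1 (x - 1) 1; have -> : -1 < x - 1 <= 1 by lra.
by move=> /(_ isT (lexx _)) ?; lra.
Qed.

(** [rho] solves the equation for [v = 0]. For larger [v] the gap is smaller, so [rho] is a
    supersolution, and a subsolution up to the defect in [le_gap]. *)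
Lemma mu_series_dickman u v : 1 <= u -> 0 <= v <= 1 ->
  (mu_series 1 u v <= (rho u)%:E)%E /\
  ((rho u)%:E <= mu_series 1 u v + (2 * v / u)%:E)%E.
Proof.
move=> u1 /[dup] v01 /andP[v0 v1].
have cm (y : R) : 0 < y -> {for y, continuous r} by move=> _; exact: continuous_clamped.
have dM (y : R) : 0 < y -> is_derive y 1 M (r y).
  by move=> y0; apply: is_derive_primitive; lra.
rewrite -clamped_ge0; last lra.
(* On [[1, u]] this is [v min(x, 2)]; the outer maximum makes it nonnegative everywhere. *)
pose E x := v * Num.max 0 (Num.min x 2).
pose d x := if x <= 2 then v else 0.
have E0 x : 0 <= E x by rewrite mulr_ge0// le_max lexx.
have mE : measurable_fun setT E.
  apply: measurable_funM; first exact: measurable_cst.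
  apply: measurable_maxr; first exact: measurable_cst.
  by apply: measurable_minr; [exact: measurable_id|exact: measurable_cst].
have [|x xu|x xu|x xu|x xu|up low] := @mu_series_bounds _ 1 u v r M E d ltr01 u1 _ mE E0 cm dM.
- exact: continuous_measurable_fun continuous_clamped.
- apply: (delay_ge0 cm dM (gap_ge0 0) _ xu) => {xu} x /andP[x1 _].
  exact: dickman_gap.
- case/andP: xu => x1 _; rewrite !mul1r (dickman_gap x1) lerD2r.
  exact: gap_le.
- case/andP: xu => x1 _; rewrite !mul1r (dickman_gap x1).
  by have := le_gap v01 x1; rewrite -/(d x); lra.
- case/andP: xu => x1 _; rewrite mul1e.
  have cv (y : R) : 0 < y -> {for y, continuous (cst v : R -> R)}.
    by move=> _; exact: cvg_cst.
  have dv (y : R) : 0 < y -> is_derive y 1 (fun y => v * y) v.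
    by move=> _; rewrite -[X in is_derive _ _ _ X]mulr1; exact: (is_deriveZ v (is_derive_id y 1)).
  have TE : (transfer (EFin \o E) x <= transfer (fun y => (y * v)%:E) x)%E.
    apply: le_transfer.
    - exact/measurable_EFinP.
    - by apply/measurable_EFinP; apply: measurable_funM.
    - by move=> y _; rewrite lee_fin.
    - move=> y /andP[y1 _]; rewrite lee_fin [(y * v)%R]mulrC; apply: ler_wpM2l => //.
      by rewrite ge_max ge_min lexx andbT; lra.
  rewrite (transfer_primitive x1 cv dv) in TE.
  (* The bound is [d(x) + v (x - max(1, x - 1))]: this is [v + v (x - 1) = v x] for [x <= 2], and
     [0 + v <= 2 v] beyond. *)
  apply: le_trans (leeD2l _ TE) _; rewrite -EFinD lee_fin /E /d.
  rewrite (max_r (_ : 0 <= Num.min x 2)); last by rewrite le_min; apply/andP; split; lra.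
  case: (leP x 2) => x2.
    by rewrite max_l; nra.
  by rewrite max_r; nra.
split=> //; apply: (le_trans low); apply: leeD2l; rewrite lee_fin.
rewrite ler_wpM2r ?invr_ge0//; first lra.
rewrite mulrC /E; apply: ler_wpM2l => //.
by rewrite ge_max ge_min lexx orbT andbT.
Qed.

End Dickman.

(** * Parameter ranges of the three claims *)

Theorem proposition1p4 (R : realType) :
  [/\ forall u theta kappa : R,
        1 <= u -> 0 < theta <= 1 -> (1 - theta) * u <= 1 -> 0 < kappa ->
        theta <= 1 / 2 -> 1 < u <= 1 / (1 - theta) ->
        varrho theta kappa u =
          (kappa * (1 - (1 - theta) * u) * u `^ (kappa - 1))%:E,
      forall u theta : R,
        1 <= u -> 0 < theta <= 1 -> (1 - theta) * u <= 1 ->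
        1 / 2 < theta <= 2 / 3 ->
        [/\ 1 < u <= 1 / theta ->
              varrho theta 1 u = (1 - (1 - theta) * u)%:E,
            1 / theta < u <= 2 ->
              varrho theta 1 u =
                (1 - (1 - theta) * u + ln (1 / u + 1 - theta))%:E
          & 2 < u <= 1 / (1 - theta) ->
              varrho theta 1 u =
                (1 - (1 - theta) * u + ln (1 / u + 1 - theta)
                 + (1 - theta) * u * ln (u / 2))%:E]
    & forall rho : R -> R, is_dickman rho ->
        exists C : R, forall u theta epsilon : R,
          1 <= u -> 0 < theta <= 1 -> (1 - theta) * u <= 1 -> 0 < epsilon ->
          theta = 1 - epsilon ->
          (`|varrho theta 1 u - (rho u)%:E| <= (C * epsilon)%:E)%E].
Proof.
split.
- move=> u theta kappa u1 /andP[t0 t1] v1 k0 t2 _.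
  (* From [theta <= 1 - theta] follows [theta u <= (1 - theta) u <= 1], that is [u <= 1 + v]. *)
  apply: mu_series_powR => //; apply/andP; split; nra.
- move=> u theta u1 /andP[t0 t1] v1 /andP[t2 t3]; rewrite /varrho.
  set v := (1 - theta) * u in v1 *.
  have v0 : 0 <= v by rewrite mulr_ge0; lra.
  have mu : u <= 2 + v -> mu_series 1 u v = (1 - v
      - (ln (Num.max u (1 + v)) - ln (1 + v)) + v * (ln (Num.max u 2) - ln 2))%:E.
    by move=> uv; rewrite mu_series_ln// ?v0 ?u1.
  have ln_quotient : ln (1 / u + 1 - theta) = ln (1 + v) - ln u.
    rewrite -ln_div ?posrE; try lra.
    by congr ln; rewrite /v; field; lra.
  (* The breakpoint [u = 1 / theta] is exactly where [u = 1 + v]. *)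
  split=> /andP[].
  + move=> _; rewrite ler_pdivlMr// => ut.
    have uv : u <= 1 + v by rewrite /v; lra.
    have u2 : u <= 2 by lra.
    by rewrite mu; [rewrite !max_r//; congr EFin; ring|lra].
  + rewrite ltr_pdivrMr// => ut u2.
    have uv : 1 + v <= u by rewrite /v; lra.
    rewrite mu; last lra.
    by rewrite ln_quotient (max_l uv) (max_r u2); congr EFin; ring.
  + move=> u2 _.
    have uv : 1 + v <= u by lra.
    (* Here [theta <= 2 / 3] enters: [theta u <= 2 (1 - theta) u <= 2], that is [u <= 2 + v]. *)
    have tu : 0 <= (2 - 3 * theta) * u by rewrite mulr_ge0; lra.
    have u2v : u <= 2 + v by move: v1; rewrite /v; lra.
    have lnu2 : ln (u / 2) = ln u - ln 2 by rewrite ln_div ?posrE//; lra.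
    by rewrite mu// ln_quotient lnu2 (max_l uv) (max_l (ltW u2)); congr EFin; ring.
(* The error [2 v / u] with [v = eps u] equals [2 eps], whence the constant. *)
- move=> rho rhoP; exists 2 => u theta eps u1 _ v1 eps0 te.
  have eu : (1 - theta) * u = eps * u by rewrite te; ring.
  rewrite /varrho eu; rewrite eu in v1; set v := eps * u in v1 *.
  have v0 : 0 <= v by rewrite mulr_ge0; lra.
  have v01 : 0 <= v <= 1 by rewrite v0.
  have [up low] := mu_series_dickman rhoP u1 v01.
  have mu0 : (0 <= mu_series 1 u v)%E.
    rewrite mu_series_mass//; apply: mule_ge0; first by rewrite lee_fin invr_ge0; lra.
    by apply: nneseries_ge0 => i *; rewrite mule_ge0 ?mass_ge0 ?lee_fin ?exprn_ge0.
  have mu_fin : mu_series 1 u v \is a fin_num.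
    by rewrite ge0_fin_numE// (le_lt_trans up) ?ltry.
  move: up low; rewrite -(fineK mu_fin) -EFinB lee_fin -EFinD lee_fin => up low.
  have vu : v / u = eps by rewrite /v mulfK//; lra.
  rewrite -mulrA vu in low.
  by rewrite abse_EFin lee_fin distrC ger0_norm ?subr_ge0//; lra.
Qed.
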